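(* Let $0<\alpha<1$ and let $\mu,\mu'$ be two probability measures on a finite set $\Omega$. For all subsets $\Omega_1\subset\Omega$, $$\alpha\big(\mu(\Omega_1)-\mu'(\Omega_1)\big)-\log\frac{\displaystyle\int_{\Omega_1}\Big(\frac{d\mu}{d\mu'}\Big)^{\alpha}d\mu'+\Big(\Big(\int_{\Omega_1}\Big(\frac{d\mu}{d\mu'}\Big)^{\alpha}d\mu'\Big)^2-\mu'(\Omega_1)^2+1\Big)^{1/2}}{1+\mu'(\Omega_1)}\ \ge\ 0,$$ with equality if and only if $\mu=\mu'$ on $\Omega_1$.
   Context: Here $\frac{d\mu}{d\mu'}$ is the ratio of the probability densities, so for the finite set $\Omega$ one has $\int_{\Omega_1}(\frac{d\mu}{d\mu'})^\alpha d\mu'=\sum_{\omega\in\Omega_1}\mu(\{\omega\})^\alpha\mu'(\{\omega\})^{1-\alpha}$ (with $0^\alpha=0^{1-\alpha}=0$). The convention $-\log0=+\infty$ is used. ''$\mu=\mu'$ on $\Omega_1$'' means $\mu(\{\omega\})=\mu'(\{\omega\})$ for all $\omega\in\Omega_1$. *)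

(* Defs.v *)
From HB Require Import structures.
From mathcomp Require Import all_boot all_order all_algebra.
From mathcomp Require Import all_classical all_reals all_analysis.
Set Implicit Arguments.
Unset Strict Implicit.
Unset Printing Implicit Defensive.
Import Order.TTheory GRing.Theory Num.Theory.
Import numFieldNormedType.Exports.
Local Open Scope classical_set_scope.
Local Open Scope ring_scope.

Definition mass d (T : measurableType d) (R : realType) (P : probability T R)
  (A : set T) : R := fine (P A).

(* Ratio of the densities with respect to the counting measure.  At a point
   where the second density vanishes the value is the junk value 0; such points
   are null for Q, hence invisible in integrals with respect to Q. *)
Definition density_ratio d (T : measurableType d) (R : realType)
  (P Q : probability T R) (w : T) : R := mass P [set w] / mass Q [set w].

Definition power_integral d (T : measurableType d) (R : realType)
  (P Q : probability T R) (a : R) (A : set T) : R :=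
  \int[Q]_(w in A) (density_ratio P Q w `^ a).

(* On a finite discrete space with 0 < a < 1, the integral is the sum of
   P({w})^a Q({w})^(1-a), with 0^a = 0^(1-a) = 0. *)
Lemma power_integralE (R : realType) (d : measure_display)
    (T : measurableType d) (finT : finite_set [set: T])
    (discT : forall A : set T, measurable A)
    (P Q : probability T R) (a : R) (A : set T) :
  0 < a -> a < 1 ->
  power_integral P Q a A =
  \sum_(w \in A) (mass P [set w] `^ a * mass Q [set w] `^ (1 - a)).
Proof.
move=> a0 a1; rewrite /power_integral /Rintegral.
have finA : finite_set A by apply: sub_finite_set finT.
have mass_ge0 (M : probability T R) B : 0 <= mass M B by rewrite fine_ge0.
have AE : \bigcup_(w in A) [set w] = A by rewrite bigcup_imset1 image_id.
rewrite -{1}AE -bigsetU_fset_set//.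
rewrite ge0_integral_bigsetU//=; first last.
- by move=> x _; rewrite lee_fin powR_ge0.
- by move=> i j Di Dj [x [-> ->]].
rewrite fsbig_finite//=.
rewrite (eq_bigr (fun w => (mass P [set w] `^ a * mass Q [set w] `^ (1 - a))%:E)).
  by rewrite sumEFin.
move=> w _.
rewrite (eq_integral (cst (density_ratio P Q w `^ a)%:E)); last first.
  by move=> x /set_mem ->.
rewrite integral_cst//= -(@fineK _ (Q [set w])) ?fin_num_measure//.
rewrite -/(mass Q [set w]) -EFinM; congr (_%:E).
rewrite /density_ratio.
have := mass_ge0 Q [set w]; rewrite le_eqVlt => /predU1P[<-|q0].
  by rewrite mulr0 powR0 ?mulr0// subr_eq0 gt_eqF.
rewrite powRM ?invr_ge0 ?mass_ge0 ?ltW// -mulrA; congr (_ * _).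
rewrite -powR_inv1 ?ltW// -powRrM mulN1r.
rewrite -{2}(powRr1 (ltW q0)) -powRD; first by rewrite addrC.
by rewrite (gt_eqF q0) implybT.
Qed.

(* Main.v *)
(** Put x = mu(Omega1), y = mu'(Omega1) and s = alpha (x - y).  Pointwise Young
    inequality gives I <= alpha x + (1 - alpha) y = y + s, with equality iff
    mu = mu' on Omega1.  Isolating the square root, the claim becomes
    I <= sinh s + y cosh s, and y + s <= sinh s + y cosh s holds as soon as
    -y <= s and 0 <= y; hence equality in the claim forces equality in Young. *)
Require Import Defs.
From HB Require Import structures.
From mathcomp Require Import all_boot all_order all_algebra.
From mathcomp Require Import all_classical all_reals all_analysis.
From mathcomp Require Import ring lra.
Set Implicit Arguments.
Unset Strict Implicit.
Unset Printing Implicit Defensive.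
Import Order.TTheory GRing.Theory Num.Theory.
Import numFieldNormedType.Exports.
Local Open Scope classical_set_scope.
Local Open Scope ring_scope.

(** Weighted AM-GM. For positive [x] and [y], divide by the geometric mean [expR l] and apply the
    tangent bound [1 + t <= expR t], strict for nonzero [t], to the two logarithmic deviations from
    [l]. A zero argument makes the product vanish and is settled directly. *)
Lemma powR_young_leif (R : realType) (a x y : R) : 0 < a -> a < 1 ->
  0 <= x -> 0 <= y ->
  x `^ a * y `^ (1 - a) <= a * x + (1 - a) * y ?= iff (x == y).
Proof.
move=> a0 a1; rewrite le_eqVlt => /predU1P[<- y0|x0].
  rewrite powR0 ?(gt_eqF a0)// mul0r mulr0 add0r; split.
    by rewrite mulr_ge0// subr_ge0 ltW.
  by rewrite eq_sym mulf_eq0 subr_eq0 (gt_eqF a1) eq_sym.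
rewrite le_eqVlt => /predU1P[<-|y0].
  rewrite powR0 ?subr_eq0 ?(gt_eqF a1)// !mulr0 addr0; split.
    by rewrite mulr_ge0// ltW.
  by rewrite eq_sym mulf_eq0 (gt_eqF a0).
pose l := a * ln x + (1 - a) * ln y.
have lE : x `^ a * y `^ (1 - a) = expR l.
  by rewrite /powR !gt_eqF// -expRD.
have xE : x = expR l * expR (ln x - l) by rewrite -expRD addrC subrK lnK.
have yE : y = expR l * expR (ln y - l) by rewrite -expRD addrC subrK lnK.
have l0 := expR_gt0 l.
have [<-|xy] := eqVneq x y.
  suff -> : x `^ a * x `^ (1 - a) = a * x + (1 - a) * x by exact/leif_refl.
  rewrite -powRD ?(gt_eqF x0) ?implybT// subrKC powRr1 ?ltW//; ring.
suff lt : x `^ a * y `^ (1 - a) < a * x + (1 - a) * y.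
  by split; [exact: ltW|rewrite lt_eqF].
have xl : ln x - l != 0.
  have -> : ln x - l = (1 - a) * (ln x - ln y) by rewrite /l; ring.
  rewrite mulf_neq0 ?subr_eq0 ?(gt_eqF a1)//.
  by apply: contra_neq xy => /ln_inj; apply; rewrite posrE.
have hx := expR_gt1Dx xl.
have hy := expR_ge1Dx (ln y - l).
rewrite lE [in ltRHS]xE [in ltRHS]yE mulrCA [X in _ + X]mulrCA -mulrDr.
rewrite ltr_pMr//.
(* The weighted deviations from [l] sum to 0, so the constant 1 splits into the two tangent lines;
   one of them being strict is enough. *)
rewrite [ltLHS](_ : _ = a * (1 + (ln x - l)) + (1 - a) * (1 + (ln y - l))); last first.
  by rewrite /l; ring.
by apply: ltr_leD; rewrite ?ltr_pM2l// ?ler_pM2l// subr_gt0.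
Qed.

(** The derivative of [expR x - expR (- x)] is at least 2, and the mean value theorem on [[0, s]]
    applies. *)
Lemma sinh_ge (R : realType) (s : R) : 0 <= s -> 2 * s <= expR s - expR (- s).
Proof.
move=> s0.
pose f (x : R) := expR x - expR (- x).
have fd (x : R) : is_derive x 1 f (expR x + expR (- x)).
  by apply: is_derive_eq; rewrite mulrN1 opprK.
have [|c _] := MVT_segment s0 (fun x _ => fd x).
  by apply: derivable_within_continuous => x _; exact: ex_derive.
rewrite /f oppr0 subrr !subr0 addr0 => ->; rewrite ler_wpM2r//.
by have := expR_ge1Dx c; have := expR_ge1Dx (- c); lra.
Qed.

(** The bound [tanh u <= u]: the difference of the two sides vanishes at 0 and has derivative
    [x * (expR x - expR (- x))], nonnegative for [x >= 0]. *)
Lemma sinh_le_cosh (R : realType) (u : R) : 0 <= u ->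
  expR u - expR (- u) <= u * (expR u + expR (- u)).
Proof.
move=> u0.
pose f (x : R) := x * (expR x + expR (- x)) - (expR x - expR (- x)).
have fd (x : R) : is_derive x 1 f (x * (expR x - expR (- x))).
  by apply: is_derive_eq; rewrite /GRing.scale/=; ring.
have [|c] := MVT_segment u0 (fun x _ => fd x).
  by apply: derivable_within_continuous => x _; exact: ex_derive.
rewrite in_itv/= => /andP[c0 _].
rewrite /f mul0r oppr0 subrr !subr0 addr0 -subr_ge0 => ->.
by rewrite !mulr_ge0// (le_trans _ (sinh_ge c0))// mulr_ge0.
Qed.

(** The right-hand side is [2 * (sinh s + y * cosh s)]. For [s >= 0], the bounds [sinh s >= s] and
    [cosh s >= 1] suffice. *)
Lemma sinh_cosh_ge (R : realType) (y s : R) : 0 <= y -> - y <= s ->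
  2 * (y + s) <= (1 + y) * expR s - (1 - y) * expR (- s).
Proof.
move=> y0 ys.
have cosh1 : 0 <= expR s + expR (- s) - 2.
  by have := expR_ge1Dx s; have := expR_ge1Dx (- s); lra.
have [s0|s0] := leP 0 s.
  by have := sinh_ge s0; have := mulr_ge0 y0 cosh1; lra.
(* For negative [s], half the difference of the two sides is [(y + s) * (cosh s - 1) + (sinh s - s *
   cosh s)], with both summands nonnegative. *)
have sN0 : 0 <= - s by rewrite oppr_ge0 ltW.
have := sinh_le_cosh sN0; rewrite opprK.
have : 0 <= (y + s) * (expR s + expR (- s) - 2).
  by rewrite mulr_ge0//; lra.
lra.
Qed.

(** Isolate the root and square. With [k = (1 + y) * m], the difference of the squares factors as
    [k * (k - (1 - y) / m - 2 * i)]; since [k > 0], its sign and its vanishing are those of the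
    second factor. *)
Lemma addr_sqrtr_leif (R : rcfType) (i y m : R) : 0 <= i -> 0 <= y <= 1 ->
  0 < m -> 2 * i <= (1 + y) * m - (1 - y) / m ->
  i + Num.sqrt (i ^+ 2 - y ^+ 2 + 1) <= (1 + y) * m
    ?= iff (2 * i == (1 + y) * m - (1 - y) / m).
Proof.
move=> i0 /andP[y0 y1] m0 ile.
have k0 : 0 < (1 + y) * m by rewrite mulr_gt0// ltr_pwDl.
have mi0 : 0 <= (1 + y) * m - i.
  have : 0 <= (1 - y) / m by rewrite divr_ge0 ?subr_ge0// ltW.
  lra.
have D0 : 0 <= i ^+ 2 - y ^+ 2 + 1.
  by have := sqr_ge0 i; have := exprn_ile1 2 y0 y1; lra.
have E : ((1 + y) * m - i) ^+ 2 - (i ^+ 2 - y ^+ 2 + 1) =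
    (1 + y) * m * ((1 + y) * m - (1 - y) / m - 2 * i).
  by field; rewrite gt_eqF.
have -> : (2 * i == (1 + y) * m - (1 - y) / m) =
    (i ^+ 2 - y ^+ 2 + 1 == ((1 + y) * m - i) ^+ 2).
  rewrite [LHS]eq_sym -[LHS]subr_eq0 [RHS]eq_sym -[RHS]subr_eq0 E mulf_eq0.
  by rewrite (gt_eqF k0).
have le : i ^+ 2 - y ^+ 2 + 1 <= ((1 + y) * m - i) ^+ 2.
  by rewrite -subr_ge0 E mulr_ge0 ?(ltW k0)// subr_ge0.
set D := i ^+ 2 - y ^+ 2 + 1 in D0 le *.
rewrite -[X in _ <= X ?= iff _](subrKC i) (mono_leif (lerD2l i)).
rewrite -[X in _ <= X ?= iff _](ger0_norm mi0) -sqrtr_sqr.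
split; first by rewrite ler_wsqrtr.
(* Equal roots give equal radicands because [D0] excludes negative [D], where [Num.sqrt] takes the
   default value 0. *)
apply/eqP/eqP => [h|->//].
by rewrite -(sqr_sqrtr D0) h sqr_sqrtr ?sqr_ge0.
Qed.

(** Exponentiation removes the logarithm. For [z <= 0] the value of [lne] is [-oo], so the
    difference is [+oo], in agreement with [z <= 0 < expR s]. *)
Lemma sube_lne_ge0 (R : realType) (s z : R) :
  (0 <= s%:E - lne z%:E)%E = (z <= expR s).
Proof.
rewrite /lne; case: ifPn => [z0|]; first by rewrite leey (le_trans z0) ?expR_ge0.
by rewrite -ltNge => z0; rewrite -EFinB lee_fin subr_ge0 -[LHS]ler_expR lnK.
Qed.

Lemma sube_lne_eq0 (R : realType) (s z : R) :
  (s%:E - lne z%:E == 0)%E = (z == expR s).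
Proof.
rewrite /lne; case: ifPn => [z0|].
  by rewrite [RHS]lt_eqF// (le_lt_trans z0) ?expR_gt0.
rewrite -ltNge => z0; rewrite -EFinB eqe subr_eq0 -[LHS](inj_eq (@expR_inj R)).
by rewrite lnK// eq_sym.
Qed.

Lemma mass_ge0 (R : realType) (d : measure_display) (T : measurableType d)
  (P : probability T R) (A : set T) : 0 <= mass P A.
Proof. exact: fine_ge0. Qed.

Lemma mass_eqE (R : realType) (d : measure_display) (T : measurableType d)
    (P Q : probability T R) (A : set T) : measurable A ->
  mass P A = mass Q A <-> P A = Q A.
Proof.
move=> mA; split=> [PQ|]; last by rewrite /mass => ->.
by rewrite -[LHS]fineK ?fin_num_measure// -[RHS]fineK ?fin_num_measure//; congr EFin.
Qed.

Lemma mass_fsbig (R : realType) (d : measure_display) (T : measurableType d)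
    (P : probability T R) (A : set T) : finite_set A ->
  (forall w, A w -> measurable [set w]) ->
  mass P A = \sum_(w \in A) mass P [set w].
Proof.
move=> finA mA.
rewrite -[A in LHS]image_id -bigcup_imset1.
rewrite /mass measure_fin_bigcup//=; last by move=> i j _ _ [x [-> ->]].
rewrite !fsbig_finite//= big_seq.
under eq_bigr => w wA.
  rewrite -[P _]fineK; last first.
    by rewrite fin_num_measure//; apply: mA; move: wA; rewrite in_fset_set// inE.
  over.
by rewrite -big_seq sumEFin.
Qed.

Section power_integral_young.
Context (R : realType) (d : measure_display) (T : measurableType d).
Hypotheses (finT : finite_set [set: T]) (discT : forall A : set T, measurable A).
Variables (P Q : probability T R) (a : R) (A : set T).
Hypotheses (a0 : 0 < a) (a1 : a < 1).

(** The pointwise deficit in Young's inequality. Its sum over [A] is the deficit of the integrated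
    inequality, which therefore vanishes only if every term does. *)
Let gap w := a * mass P [set w] + (1 - a) * mass Q [set w] -
  mass P [set w] `^ a * mass Q [set w] `^ (1 - a).

Let gap_ge0 w : 0 <= gap w.
Proof. by rewrite subr_ge0 powR_young_leif ?mass_ge0. Qed.

Let finA : finite_set A. Proof. exact: sub_finite_set finT. Qed.

Let sum_gap : a * mass P A + (1 - a) * mass Q A - power_integral P Q a A =
  \sum_(w \in A) gap w.
Proof.
rewrite (power_integralE finT discT)// !(mass_fsbig _ finA)//.
by rewrite !fsbig_finite//= !mulr_sumr -big_split -sumrB.
Qed.

Lemma power_integral_young :
  power_integral P Q a A <= a * mass P A + (1 - a) * mass Q A.
Proof. by rewrite -subr_ge0 sum_gap fsumr_ge0. Qed.

Lemma power_integral_young_eq :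
  power_integral P Q a A = a * mass P A + (1 - a) * mass Q A <->
  forall w, A w -> P [set w] = Q [set w].
Proof.
split=> [/esym/eqP|PQ].
  rewrite -subr_eq0 sum_gap => /eqP sum0 w Aw.
  have /eqP := pfsumr_eq0 finA (fun w _ => gap_ge0 w) sum0 Aw.
  rewrite subr_eq0 eq_sym powR_young_leif ?mass_ge0// => /eqP.
  by move/(mass_eqE _ _ (discT _)).
apply/esym/eqP; rewrite -subr_eq0 sum_gap fsbig1// => w /PQ wPQ.
apply/eqP; rewrite subr_eq0 eq_sym powR_young_leif ?mass_ge0//.
by rewrite /mass wPQ.
Qed.

End power_integral_young.

Theorem proposition15 (R : realType) (alpha : R)
    (halpha0 : 0 < alpha) (halpha1 : alpha < 1)
    (d : measure_display) (Omega : measurableType d)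
    (finOmega : finite_set [set: Omega])
    (discOmega : forall A : set Omega, measurable A)
    (mu mu' : probability Omega R) (Omega1 : set Omega) :
  let I := power_integral mu mu' alpha Omega1 in
  let lhs : \bar R :=
    ((alpha * (mass mu Omega1 - mass mu' Omega1))%:E
     - lne ((I + Num.sqrt (I ^+ 2 - mass mu' Omega1 ^+ 2 + 1))
            / (1 + mass mu' Omega1))%:E)%E in
  (0%E <= lhs)%E /\
  (lhs = 0%E <-> forall w, Omega1 w -> mu [set w] = mu' [set w]).
Proof.
move=> I lhs; set x := mass mu Omega1; set y := mass mu' Omega1.
pose s := alpha * (x - y).
have finO : finite_set Omega1 by exact: sub_finite_set finOmega.
have x0 : 0 <= x := mass_ge0 mu Omega1.
have y0 : 0 <= y := mass_ge0 mu' Omega1.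
have y1 : y <= 1.
  by rewrite -lee_fin fineK ?fin_num_measure// probability_le1.
have I0 : 0 <= I.
  rewrite /I (power_integralE finOmega discOmega)// fsumr_ge0// => w _.
  by rewrite mulr_ge0 ?powR_ge0.
have ysE : y + s = alpha * x + (1 - alpha) * y by rewrite /s; ring.
have Iys : I <= y + s by rewrite ysE power_integral_young.
(* The range of [s] comes from [0 <= I <= y + s]. *)
have ys0 : - y <= s by rewrite -subr_ge0 opprK addrC (le_trans I0).
have rhs_ge : 2 * (y + s) <= (1 + y) * expR s - (1 - y) / expR s.
  by rewrite -expRN sinh_cosh_ge.
have Irhs : 2 * I <= (1 + y) * expR s - (1 - y) / expR s.
  by rewrite (le_trans _ rhs_ge)// ler_pM2l.
have y10 : 0 < 1 + y by rewrite ltr_pwDl.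
have y01 : 0 <= y <= 1 by rewrite y0.
(* Taking [m = expR s] gives the claim after exponentiation and multiplication by [1 + y]. *)
have [main mainE] := addr_sqrtr_leif I0 y01 (expR_gt0 s) Irhs.
split; first by rewrite sube_lne_ge0 ler_pdivrMr// mulrC.
rewrite (rwP eqP) sube_lne_eq0 -(inj_eq (mulfI (lt0r_neq0 y10))) mulrC.
rewrite divfK ?(gt_eqF y10)// mainE -(rwP eqP).
(* By [h], [2 * I] equals the upper bound in [rhs_ge]; thus [y + s <= I], and with [Iys] this is
   equality in Young. *)
split=> [h|munu].
  apply: (power_integral_young_eq _ _ _ _ _ halpha0 halpha1).1 => //.
  by rewrite -/I -/x -/y -ysE; lra.
have IE : I = y + s.
  by rewrite ysE; apply/(power_integral_young_eq finOmega discOmega).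
have xy : x = y.
  rewrite /x /y !(mass_fsbig _ finO)//; apply: eq_fsbigr => w /set_mem Aw.
  by rewrite /mass munu.
have s0 : s = 0 by rewrite /s xy subrr mulr0.
(* At [s = 0] both sides reduce to [2 * y]. *)
by rewrite IE s0 expR0; lra.
Qed.
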